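(* For any vertex operator algebra $V$, one has $J(V)\cap Z(V)=J(Z(V))$.
   Context: A vertex operator algebra $V$ is a (nonzero) complex vector space with vertex operators $Y(v,z)=\sum_{n\in\mathbf{Z}} v(n)z^{-n-1}$, vacuum vector $\mathbf{1}$ and conformal vector $\omega$, $Y(\omega,z)=\sum_n L(n)z^{-n-2}$, satisfying the usual axioms; $V=\bigoplus_{n\in\mathbf{Z}}V_n$ is the $L(0)$-eigenspace grading, with $\dim V_n<\infty$ and $V_n=0$ for $n$ sufficiently small. An ideal of $V$ is a subspace $I$ with $u(n)a\in I$ for all $u\in V$, $a\in I$, $n\in\mathbf{Z}$. The Jacobson radical $J(V)$ is the intersection of all maximal (proper) ideals of $V$. The center is $Z(V)=\{v\in V\mid L(-1)v=0\}$; it is a finite-dimensional commutative associative unital algebra under $ab=a(-1)b$, and $J(Z(V))$ denotes its usual Jacobson radical as an associative algebra. *)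

(* Defs.v *)
From HB Require Import structures.
From mathcomp Require Import all_boot all_order all_algebra ring_quotient.
From mathcomp Require Import complex.
From mathcomp Require Import mathcomp_extra boolp classical_sets reals.

Set Implicit Arguments.
Unset Strict Implicit.
Unset Printing Implicit Defensive.

Import Order.TTheory GRing.Theory Num.Theory.

Local Open Scope classical_set_scope.
Local Open Scope ring_scope.
Local Open Scope complex_scope.

(* Binomial coefficient with an arbitrary integer upper entry:
   m (m - 1) ... (m - i + 1) / i!. *)
Definition zbinom (F : fieldType) (m : int) (i : nat) : F :=
  (\prod_(j < i) (m - j%:Z)%:~R) / i`!%:R.

(* [mode u n v] is u(n)v, where Y(u,z) = \sum_n u(n) z^(-n-1). *)
Record vertex_data (R : realType) := VertexData {
  carrier :> lmodType R[i];
  mode : carrier -> int -> carrier -> carrier;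
  vacuum : carrier;
  conformal : carrier;
  central_charge : R[i]
}.

Arguments mode {R v}.
Arguments vacuum {R}.
Arguments conformal {R}.
Arguments central_charge {R}.

(* Y(omega,z) = \sum_n L(n) z^(-n-2), so L(n) = omega(n+1). *)
Definition Lmode (R : realType) (V : vertex_data R) (n : int) : V -> V :=
  mode (conformal V) (n + 1).

Definition weight_space (R : realType) (V : vertex_data R) (n : int) : set V :=
  [set v | Lmode 0 v = n%:~R *: v].

Arguments weight_space {R} V n.

(* Coefficients of z0^(-l-1) z1^(-m-1) z2^(-n-1) on the two sides of the Jacobi
   identity
     z0^-1 delta((z1 - z2)/z0) Y(u,z1) Y(v,z2) w
       - z0^-1 delta((z2 - z1)/(-z0)) Y(v,z2) Y(u,z1) w
       = z2^-1 delta((z1 - z0)/z2) Y(Y(u,z0)v,z2) w,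
   with the sum over i >= 0 cut off at i < k. *)
Definition jacobi_lhs (R : realType) (V : vertex_data R)
    (l m n : int) (u v w : V) (k : nat) : V :=
  \sum_(i < k) ((-1) ^+ i * zbinom R[i] l i) *:
    (mode u (l + m - i%:Z) (mode v (n + i%:Z) w)
     - ((-1) ^ l) *: mode v (l + n - i%:Z) (mode u (m + i%:Z) w)).

Definition jacobi_rhs (R : realType) (V : vertex_data R)
    (l m n : int) (u v w : V) (k : nat) : V :=
  \sum_(i < k) zbinom R[i] m i *:
    mode (mode u (l + i%:Z) v) (m + n - i%:Z) w.

Record voa_axioms (R : realType) (V : vertex_data R) : Prop := VOAAxioms {
  voa_neq0 : exists v : V, v != 0;
  mode_linearl : forall (n : int) (w : V), linear (fun u : V => mode u n w);
  mode_linearr : forall (u : V) (n : int), linear (mode u n);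
  mode_truncated : forall u v : V,
    exists N : int, forall n : int, N <= n -> mode u n v = 0;
  vacuum_mode : forall (n : int) (v : V),
    mode (vacuum V) n v = if n == -1 then v else 0;
  creation : forall v : V, mode v (-1) (vacuum V) = v;
  creation_ge0 : forall (v : V) (n : int), 0 <= n -> mode v n (vacuum V) = 0;
  (* By [mode_truncated] the sums in the Jacobi identity are finite, so the
     partial sums are eventually constant. *)
  jacobi_identity : forall (l m n : int) (u v w : V),
    exists N : nat, forall k : nat, (N <= k)%N ->
      jacobi_lhs l m n u v w k = jacobi_rhs l m n u v w k;
  virasoro : forall (m n : int) (v : V),
    Lmode m (Lmode n v) - Lmode n (Lmode m v) =
      (m - n)%:~R *: Lmode (m + n) v +
      (if m + n == 0 then ((m ^+ 3 - m)%:~R / 12%:R * central_charge V) *: v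
       else 0);
  (* Y(L(-1)v,z) = d/dz Y(v,z) *)
  L_derivative : forall (v : V) (n : int) (w : V),
    mode (Lmode (-1) v) n w = - (n%:~R *: mode v (n - 1) w);
  (* V is the sum of the weight spaces; the sum is automatically direct, these
     being eigenspaces for distinct eigenvalues. *)
  voa_graded : forall v : V, exists (s : seq int) (f : int -> V),
    (forall n : int, weight_space V n (f n)) /\ v = \sum_(n <- s) f n;
  weight_space_findim : forall n : int, exists b : seq V,
    forall v : V, weight_space V n v ->
      exists c : 'I_(size b) -> R[i], v = \sum_(i < size b) c i *: b`_i;
  weight_bounded : exists N : int,
    forall n : int, n < N -> weight_space V n = [set 0]
}.

Record voa (R : realType) := VOA {
  voa_data :> vertex_data R;
  voaP : voa_axioms voa_data
}.

Section Ideals.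
Variables (R : realType) (V : voa R).

Definition voa_ideal (I : set V) : Prop :=
  submod_closed [in I] /\
  forall (u a : V) (n : int), I a -> I (mode u n a).

Definition voa_maximal_ideal (I : set V) : Prop :=
  [/\ voa_ideal I, I != setT &
      forall J : set V, voa_ideal J -> I `<=` J -> J = I \/ J = setT].

Definition voa_jacobson : set V :=
  \bigcap_(I in [set I | voa_maximal_ideal I]) I.

Definition center : {pred V} := [pred v : V | Lmode (-1) v == 0].

End Ideals.

Arguments voa_jacobson {R} V.
Arguments center {R} V.

(* The library's [idealr_closed I] says that I is a left ideal not containing 1,
   i.e. a proper left ideal. *)
Definition maximal_left_ideal (A : nzRingType) (I : set A) : Prop :=
  idealr_closed [in I] /\
  forall J : set A, idealr_closed [in J] -> I `<=` J -> J = I.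

Definition jacobson (A : nzRingType) : set A :=
  \bigcap_(I in [set I | maximal_left_ideal I]) I.

Arguments jacobson A : clear implicits.

Section CenterAlgebra.
Variables (R : realType) (V : voa R).
Implicit Types (a b c v w : V).

Let ax := voaP V.

Lemma mode0l n w : mode (0 : V) n w = 0.
Proof.
by have := mode_linearl ax n w (-1) 0 0; rewrite scaler0 addr0 scaleN1r addNr.
Qed.

Lemma mode0r v n : mode v n (0 : V) = 0.
Proof.
by have := mode_linearr ax v n (-1) 0 0; rewrite scaler0 addr0 scaleN1r addNr.
Qed.

Lemma modeDl n w a b : mode (a + b) n w = mode a n w + mode b n w.
Proof. by have := mode_linearl ax n w 1 a b; rewrite !scale1r. Qed.

Lemma modeZl n w (k : R[i]) a : mode (k *: a) n w = k *: mode a n w.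
Proof. by have := mode_linearl ax n w k a 0; rewrite mode0l !addr0. Qed.

Lemma center_submod_closed : submod_closed (center V).
Proof.
split=> [|k u v]; first by rewrite inE /Lmode mode0r.
rewrite !inE => /eqP hu /eqP hv; apply/eqP.
by rewrite /Lmode (mode_linearr ax) -!/(Lmode _ _) hu hv scaler0 addr0.
Qed.

HB.instance Definition _ :=
  GRing.isSubmodClosed.Build R[i] V (center V) center_submod_closed.

Lemma center_mode v n w : v \in center V -> n != -1 -> mode v n w = 0.
Proof.
rewrite inE => /eqP hv nN1.
have := L_derivative ax v (n + 1) w; rewrite hv mode0l addrK.
move/esym/eqP; rewrite oppr_eq0 scaler_eq0 intr_eq0 => /orP[|/eqP//].
by rewrite addr_eq0 (negPf nN1).
Qed.

Lemma zbinom0 (F : fieldType) i : zbinom F 0 i = (i == 0)%:R.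
Proof.
rewrite /zbinom; case: i => [|i]; first by rewrite big_ord0 fact0 divr1.
by rewrite big_ord_recl subrr mul0r mul0r.
Qed.

(* Commutator formula, in the case where u(i)v = 0 for all i >= 0. *)
Lemma mode_comm u v m n w :
  (forall i : nat, mode u i%:Z v = 0) ->
  mode u m (mode v n w) = mode v n (mode u m w).
Proof.
move=> uv0; have [N hN] := jacobi_identity ax 0 m n u v w.
have := hN N.+1 (leqnSn N); rewrite /jacobi_lhs /jacobi_rhs.
rewrite [RHS]big1; last by move=> i _; rewrite add0r uv0 mode0l scaler0.
rewrite big_ord_recl big1; last first.
  by move=> i _; rewrite zbinom0 mulr0 scale0r.
rewrite addr0 zbinom0 /= expr0 mulr1 expr0z !scale1r !add0r !subr0.
by move=> /subr0_eq.
Qed.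

Lemma center_comm a v m n w : a \in center V ->
  mode a m (mode v n w) = mode v n (mode a m w).
Proof. by move=> az; apply: mode_comm => i; rewrite center_mode. Qed.

Lemma center_mulC a b : a \in center V -> mode a (-1) b = mode b (-1) a.
Proof.
by move=> az; rewrite -{1}(creation ax b) (center_comm _ _ _ _ az) (creation ax).
Qed.

Lemma center_mulA a b c : a \in center V -> b \in center V -> c \in center V ->
  mode a (-1) (mode b (-1) c) = mode (mode a (-1) b) (-1) c.
Proof.
move=> az bz cz.
by rewrite (center_mulC c bz) (center_comm _ _ _ _ az) (center_mulC _ cz).
Qed.

Lemma center_mulP a b : a \in center V -> b \in center V ->
  mode a (-1) b \in center V.
Proof.
move=> az; rewrite !inE => /eqP bz; apply/eqP.
by rewrite /Lmode -(center_comm _ _ _ _ az) -/(Lmode _ _) bz mode0r.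
Qed.

Lemma center_vacuum : vacuum V \in center V.
Proof. by rewrite inE /Lmode (creation_ge0 ax). Qed.

Lemma vacuum_neq0 : vacuum V != 0.
Proof.
have [v] := voa_neq0 ax; apply: contraNneq => v0.
by have := vacuum_mode ax (-1) v; rewrite v0 mode0l eqxx => <-.
Qed.

Record center_alg := CenterAlg { center_val : V; _ : center_val \in center V }.

HB.instance Definition _ := [isSub for center_val].
HB.instance Definition _ := [Choice of center_alg by <:].
HB.instance Definition _ := [SubChoice_isSubLmodule of center_alg by <:].

Definition center_one : center_alg := CenterAlg center_vacuum.

Definition center_mul (x y : center_alg) : center_alg :=
  CenterAlg (center_mulP (valP x) (valP y)).

Fact center_algA : associative center_mul.
Proof.
by move=> x y z; apply: val_inj; apply: center_mulA; apply: valP.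
Qed.

Fact center_algC : commutative center_mul.
Proof. by move=> x y; apply: val_inj; apply: center_mulC; apply: valP. Qed.

Fact center_alg1 : left_id center_one center_mul.
Proof. by move=> x; apply: val_inj; rewrite /= (vacuum_mode ax) eqxx. Qed.

Fact center_algD : left_distributive center_mul +%R.
Proof. by move=> x y z; apply: val_inj; apply: modeDl. Qed.

Fact center_alg_neq0 : center_one != 0.
Proof. by rewrite -val_eqE /= vacuum_neq0. Qed.

HB.instance Definition _ := GRing.Zmodule_isComNzRing.Build center_alg
  center_algA center_algC center_alg1 center_algD center_alg_neq0.

Fact center_algZ (k : R[i]) (x y : center_alg) : k *: (x * y) = (k *: x) * y.
Proof. by apply: val_inj; rewrite /= modeZl. Qed.

HB.instance Definition _ :=
  GRing.Lmodule_isLalgebra.Build R[i] center_alg center_algZ.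
HB.instance Definition _ := GRing.Lalgebra_isComAlgebra.Build R[i] center_alg.

End CenterAlgebra.

(* Main.v *)
(** A central element a acts by the single mode a(-1), which commutes with all
    modes; hence aV + M is an ideal whenever M is.  Moreover Z(V) lies in the
    finite-dimensional space V_0, so every x in Z(V) satisfies a relation
    x^k (1 - x y) = 0 with y in Z(V).

    If M is a maximal ideal and x is central outside M, then xV + M = V, so x is
    regular modulo M, and the relation puts 1 - x y into M: thus M meets Z(V) in
    a maximal ideal.

    Conversely, if a central a in J(V) lies outside a maximal ideal I of Z(V),
    some c = 1 - a b lies in I.  The ideal cV is proper, for c v = 1 would make c
    regular on Z(V) and then invertible in Z(V) by the relation.  So c lies in
    a maximal ideal of V, which also contains a b, hence 1. *)

Require Import Defs.
From mathcomp Require Import all_boot all_order all_algebra ring_quotient.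
From mathcomp Require Import complex.
From mathcomp Require Import boolp classical_sets reals.

Set Implicit Arguments.
Unset Strict Implicit.
Unset Printing Implicit Defensive.

Import GRing.Theory.

Local Open Scope classical_set_scope.
Local Open Scope ring_scope.
Local Open Scope complex_scope.

(** The coefficient matrix of the [f i] over [b] has more rows than columns, so its left kernel
    contains a nonzero row. *)
Lemma span_dependent (F : fieldType) (E : lmodType F) (b : seq E) (n : nat)
    (f : 'I_n -> E) :
  (size b < n)%N ->
  (forall i, exists c : 'I_(size b) -> F, f i = \sum_j c j *: b`_j) ->
  exists2 u : 'rV[F]_n, u != 0 & \sum_i u 0 i *: f i = 0.
Proof.
move=> bn /choice[c fE]; pose A := \matrix_(i, j) c i j.
have /rowV0Pn[u /sub_kermxP uA u0] : kermx A != 0.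
  rewrite -mxrank_eq0 mxrank_ker subn_eq0 -ltnNge.
  exact: leq_ltn_trans (rank_leq_col A) bn.
exists u => //; under eq_bigr do rewrite fE scaler_sumr.
rewrite exchange_big big1 // => j _.
under eq_bigr do rewrite scalerA.
rewrite -scaler_suml; have /rowP/(_ j) := uA; rewrite !mxE.
by under eq_bigr do rewrite mxE; move=> ->; rewrite scale0r.
Qed.

(** Split off the largest power of X: p = q X^k with q(0) nonzero. Since q(x) = q(0) + r(x) x,
    dividing by q(0) gives 1 - x y with y = -r(x)/q(0). *)
Lemma algebraic_pi_regular (F : fieldType) (A : comAlgType F) (x : A)
    (p : {poly F}) :
  p != 0 -> horner_alg x p = 0 -> exists k y, x ^+ k * (1 - x * y) = 0.
Proof.
move=> p0; have [k [q]] := multiplicity_XsubC p 0.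
rewrite p0 polyC0 subr0 /= => q0 ->.
rewrite rmorphM rmorphXn /= horner_algX => qx.
have [|r qE] := factor_theorem (q - q.[0]%:P) 0 _.
  by rewrite /root !hornerE subrr.
have hq : horner_alg x q = q.[0]%:A + horner_alg x r * x.
  rewrite -{1}(subrK q.[0]%:P q) qE polyC0 subr0.
  by rewrite rmorphD rmorphM /= horner_algX horner_algC addrC.
exists k, (- (q.[0]^-1 *: horner_alg x r)).
suff -> : 1 - x * - (q.[0]^-1 *: horner_alg x r) = q.[0]^-1 *: horner_alg x q.
  by rewrite -scalerAr mulrC qx scaler0.
by rewrite hq mulrN opprK scalerDr scalerA mulVf // scale1r mulrC scalerAl.
Qed.

Section CenterIdeals.
Variables (R : realType) (V : voa R).

Let ax := voaP V.

(** Here a = a(-1)1, and a(-1) commutes with L(0), which kills the vacuum. *)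
Lemma center_weight0 (a : V) : a \in center V -> weight_space V 0 a.
Proof.
move=> az; rewrite /weight_space /= scale0r /Lmode -[a](creation ax).
by rewrite -(center_comm _ _ _ _ az) (creation_ge0 ax) // mode0r.
Qed.

Lemma center_pi_regular (x : center_alg V) :
  exists k y, x ^+ k * (1 - x * y) = 0.
Proof.
have [b bP] := weight_space_findim ax 0.
(* The powers x^0, ..., x^(size b) lie in V_0, hence in the span of [b]; a linear relation among
   them is a polynomial killing x. *)
have [i|u u0 ux] := @span_dependent _ _ b (size b).+1
    (fun i => center_val (x ^+ i)) (ltnSn _).
  by apply: bP; apply: center_weight0; apply: valP.
pose p := rVpoly u.
apply: (@algebraic_pi_regular _ _ x p).
  by apply: contraNneq u0 => p0; rewrite -[u]rVpolyK -/p p0 linear0.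
have -> : p = \sum_i u 0 i *: 'X^i.
  by rewrite /p /rVpoly poly_def; apply: eq_bigr => i _; rewrite valK.
apply: val_inj; rewrite [RHS](_ : _ = 0) // -[RHS]ux !raddf_sum.
apply: eq_bigr => i _.
by rewrite /= linearZ /= rmorphXn /= horner_algX modeZl (vacuum_mode ax).
Qed.

Lemma voa_ideal0 (I : set V) : voa_ideal I -> I 0.
Proof. by case=> -[]; rewrite inE. Qed.

Lemma voa_idealP (I : set V) (k : R[i]) (u v : V) :
  voa_ideal I -> I u -> I v -> I (k *: u + v).
Proof. by case=> -[_ /(_ k u v)]; rewrite !inE => + _; apply. Qed.

Lemma voa_idealD (I : set V) (u v : V) : voa_ideal I -> I u -> I v -> I (u + v).
Proof. by move=> hI Iu Iv; rewrite -[u]scale1r; apply: voa_idealP. Qed.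

Lemma voa_ideal_intro (I : set V) : I 0 ->
  (forall (k : R[i]) u v, I u -> I v -> I (k *: u + v)) ->
  (forall (u a : V) n, I a -> I (mode u n a)) -> voa_ideal I.
Proof.
by move=> I0 IP IM; split=> //; split=> [|k u v]; rewrite !inE //; apply: IP.
Qed.

Lemma voa_ideal_setT (I : set V) : voa_ideal I -> I (vacuum V) -> I = setT.
Proof.
move=> [_ IM] I1; apply/seteqP; split=> // v _.
by rewrite -(creation ax v); apply: IM.
Qed.

Lemma voa_ideal_set0 : voa_ideal [set (0 : V)].
Proof.
apply: voa_ideal_intro => //= [k u v -> ->|u a n ->]; last exact: mode0r.
by rewrite scaler0 addr0.
Qed.

Lemma voa_ideal_adjoin (a : V) (M : set V) : a \in center V -> voa_ideal M ->
  voa_ideal [set mode a (-1) v + m | v in setT & m in M].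
Proof.
move=> az hM; apply: voa_ideal_intro.
- by exists 0 => //; exists 0; [exact: voa_ideal0|rewrite mode0r addr0].
- move=> k _ _ [u _ [m Mm <-]] [v _ [m' Mm' <-]].
  exists (k *: u + v) => //; exists (k *: m + m'); first exact: voa_idealP.
  by rewrite (mode_linearr ax) scalerDr addrACA.
- move=> u _ n [v _ [m Mm <-]].
  exists (mode u n v) => //; exists (mode u n m); first by case: hM => _; apply.
  rewrite (center_comm _ _ _ _ az).
  by have := mode_linearr ax u n 1 (mode a (-1) v) m; rewrite !scale1r.
Qed.

Lemma voa_maximal_ideal_exists (I : set V) : voa_ideal I -> ~ I (vacuum V) ->
  exists2 M, voa_maximal_ideal M & I `<=` M.
Proof.
move=> hI I1.
(* Zorn's lemma also asks for [P] on the union of the empty chain, the empty set; joining I inside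
   [P] makes this hold. *)
pose P X := voa_ideal (X `|` I) /\ ~ (X `|` I) (vacuum V).
have [F FP Ftot|A [[hA A1] Amax]] := @Zorn_bigcup V P.
  have [->|/set0P[X0 FX0]] := eqVneq F set0.
    by rewrite bigcup_set0 /P set0U.
  have UE x : (\bigcup_(X in F) X `|` I) x <-> exists2 X, F X & (X `|` I) x.
    split=> [[[X FX Xx]|Ix]|[X FX [Xx|Ix]]].
    - by exists X => //; left.
    - by exists X0 => //; right.
    - by left; exists X.
    - by right.
  split; last by move=> /UE[X /FP[]].
  apply: voa_ideal_intro.
  - by right; apply: voa_ideal0.
  - move=> k u v /UE[X FX Xu] /UE[Y FY Yv]; apply/UE.
    have [XY|YX] := Ftot _ _ FX FY.
      exists Y => //; apply: voa_idealP => //; first by case: (FP _ FY).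
      exact: (setSU XY).
    exists X => //; apply: voa_idealP => //; first by case: (FP _ FX).
    exact: (setSU YX).
  - move=> u a n /UE[X FX Xa]; apply/UE; exists X => //.
    by have [[_ XM] _] := FP _ FX; apply: XM.
exists (A `|` I); last by move=> x Ix; right.
split=> //; first by apply/eqP => AT; apply: A1; rewrite AT.
move=> J hJ AIJ; have [J1|J1] := pselect (J (vacuum V)).
  by right; apply: voa_ideal_setT.
left; have JI : J `|` I = J by apply/setUidPl => x Ix; apply: AIJ; right.
(* J contains A and satisfies [P], so maximality of A leaves only the case of J inside A. *)
have [JA|JA] := pselect (J `<=` A).
  by apply/seteqP; split=> // x /JA; left.
by have [] := Amax J; [split=> // x Ax; apply: AIJ; left|rewrite /P JI].
Qed.

(** Replaces an inverse v of x modulo M, possibly not central, by a central one. For central z, z =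
    z(1 - x v) + v(x z), so x z in M forces z in M; this cancels x^k in x^k (1 - x y) = 0. *)
Lemma center_unit_mod (M : set V) (x : center_alg V) (v : V) : voa_ideal M ->
  M (vacuum V - mode (center_val x) (-1) v) ->
  exists y, M (center_val (1 - x * y)).
Proof.
move=> hM Mxv; have [k [y xy]] := center_pi_regular x.
have MM u m : M m -> M (mode u (-1) m) by case: hM => _; apply.
have xz : center_val x \in center V := valP x.
have xreg z : M (center_val (x * z)) -> M (center_val z).
  move=> Mxz; have zz : center_val z \in center V := valP z.
  suff <- : mode (center_val z) (-1) (vacuum V - mode (center_val x) (-1) v)
      + mode v (-1) (center_val (x * z)) = center_val z.
    by apply: voa_idealD => //; apply: MM.
  have -> : mode v (-1) (center_val (x * z)) =
      mode (center_val z) (-1) (mode (center_val x) (-1) v).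
    rewrite (center_comm _ _ _ _ zz) (center_mulC v zz).
    by rewrite (center_comm _ _ _ _ xz).
  have := mode_linearr ax (center_val z) (-1) 1
    (vacuum V - mode (center_val x) (-1) v) (mode (center_val x) (-1) v).
  by rewrite !scale1r subrK (creation ax) => <-.
exists y; have {xy} : M (center_val (x ^+ k * (1 - x * y))).
  by rewrite xy; apply: voa_ideal0.
elim: k => [|k IHk]; first by rewrite expr0 mul1r.
by rewrite exprS -mulrA => /xreg.
Qed.

Lemma maximal_idealI_center (M : set V) : voa_maximal_ideal M ->
  maximal_left_ideal [set x : center_alg V | M (center_val x)].
Proof.
move=> [hM /eqP MT Mmax].
split.
  split; rewrite ?inE //=; first exact: voa_ideal0.
    by apply/negP; rewrite inE => /(voa_ideal_setT hM).
  move=> a x y; rewrite !inE /= => Mx My.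
  by apply: voa_idealD => //; case: hM => _; apply.
move=> J [_ J1 JP] MJ; apply/seteqP; split=> // x Jx; apply: contrapT => /= Mx.
have xz : center_val x \in center V := valP x.
have [m Mm|xM|xT] := Mmax _ (voa_ideal_adjoin xz hM).
- by exists 0 => //; exists m => //; rewrite mode0r add0r.
- case: Mx; rewrite -xM; exists (vacuum V) => //; exists 0.
    exact: voa_ideal0.
  by rewrite addr0 (creation ax).
- have : [set: V] (vacuum V) by [].
  rewrite -xT => -[v _ [m Mm vm]].
  have [|y /MJ Jxy] := @center_unit_mod M x v hM.
    by rewrite -vm addrC addKr.
  (* J contains 1 - x y and x, hence 1, although it is proper. *)
  move/negP: J1; apply; rewrite -(subrK (x * y) 1) addrC mulrC.
  by apply: JP; rewrite inE // mulrC.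
Qed.

End CenterIdeals.

Theorem theorem3p7 (R : realType) (V : voa R) :
  voa_jacobson V `&` [set v : V | v \in center V] =
  @center_val R V @` jacobson (center_alg V).
Proof.
apply/seteqP; split=> [a [aJ /= az]|_ [x xJ <-]]; last first.
  split; last exact: (valP x).
  by move=> M /maximal_idealI_center; apply: xJ.
exists (CenterAlg az) => // I [[I0 I1 IP] Imax]; apply: contrapT => Ia.
rewrite inE in I0.
pose x : center_alg V := CenterAlg az.
(* Otherwise x Z(V) + I omits 1, so by maximality it equals I, which then contains x. *)
have {Imax} [b Ib] : exists b, I (1 - x * b).
  apply: contrapT => nb; apply: Ia; rewrite -/x.
  pose J := [set x * b + i | b in [set: center_alg V] & i in I].
  suff <- : J = I by exists 1 => //; exists 0; rewrite // mulr1 addr0.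
  apply: Imax; last first.
    by move=> i Ii; exists 0 => //; exists i; rewrite // mulr0 add0r.
  split.
  - by rewrite inE; exists 0 => //; exists 0; rewrite // mulr0 addr0.
  - apply/negP; rewrite inE => -[b _ [i Ii bi]]; apply: nb; exists b.
    by rewrite -bi addrC addKr.
  - move=> c _ _ /set_mem[b _ [i Ii <-]] /set_mem[d _ [j Ij <-]].
    rewrite inE; exists (c * b + d) => //; exists (c * i + j).
      by have := IP c i j; rewrite !inE; apply.
    by rewrite !mulrDr mulrCA addrACA.
pose c := 1 - x * b; have cz : center_val c \in center V := valP c.
(* The ideal cV, obtained by adjoining c to the zero ideal. *)
have hc := voa_ideal_adjoin cz (voa_ideal_set0 V).
have [|M Mmax cM] := voa_maximal_ideal_exists hc.
  move=> [v _ [_ -> cv]].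
  (* Modulo the zero ideal, c v = 1 yields a central inverse y of c, and then 1 = c y lies in I. *)
  have [|y] := @center_unit_mod _ V [set 0] c v (voa_ideal_set0 V).
    by rewrite -cv addr0 subrr.
  move=> cy0; have /subr0_eq cy : 1 - c * y = 0 by apply: val_inj.
  move/negP: I1; apply; rewrite cy mulrC -[_ * _]addr0.
  by apply: IP; rewrite ?inE.
(* M contains c and a, hence 1 = c + b a, against properness. *)
have [hM /eqP MT _] := Mmax; apply: MT; apply: voa_ideal_setT => //.
have -> : vacuum V = center_val c + center_val (b * x).
  by rewrite mulrC -[RHS]/(center_val (c + x * b)) subrK.
apply: voa_idealD => //.
  apply: cM; exists (vacuum V) => //; exists 0 => //.
  by rewrite addr0 (creation (voaP V)).
by case: hM => _; apply; apply: (aJ M).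
Qed.
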